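(* Let $n\ge1$. The smooth type of the manifold $M_{\mathrm{St}_n,\lambda}$ of isospectral Hermitian arrow matrices does not depend on the simple spectrum $\lambda$: for any two sets $\lambda=\{\lambda_0<\dots<\lambda_n\}$ and $\lambda'=\{\lambda'_0<\dots<\lambda'_n\}$ of distinct real numbers, the manifolds $M_{\mathrm{St}_n,\lambda}$ and $M_{\mathrm{St}_n,\lambda'}$ are diffeomorphic.
   Context: Rows and columns are indexed by $0,1,\dots,n$. A Hermitian arrow matrix is a Hermitian $(n+1)\times(n+1)$-matrix whose entries vanish outside the main diagonal, the row $0$ and the column $0$. $M_{\mathrm{St}_n}\cong\mathbb{R}^{n+1}\times\mathbb{C}^n$ is the real vector space of such matrices, and $M_{\mathrm{St}_n,\lambda}\subset M_{\mathrm{St}_n}$ is the subset of matrices with spectrum $\lambda$; it is a smooth manifold of dimension $2n$ (a smooth submanifold of $M_{\mathrm{St}_n}$). *)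

(* Defs.v *)
From HB Require Import structures.
From mathcomp Require Import all_boot all_order all_algebra.
From mathcomp Require Import all_classical all_reals all_analysis.
From mathcomp Require Import complex.

Set Implicit Arguments.
Unset Strict Implicit.
Unset Printing Implicit Defensive.

Import Order.TTheory GRing.Theory Num.Theory.
Import numFieldNormedType.Exports.

Local Open Scope classical_set_scope.
Local Open Scope ring_scope.
Local Open Scope complex_scope.

(* C^k on U.  For open U and finite-dimensional V, W this is the usual class:  *)
(* f is C^(k+1) iff it is differentiable and all its directional derivatives   *)
(* are C^k.                                                                    *)
Fixpoint Ck_on {R : realType} {V W : normedModType R} (k : nat) (U : set V)
    (f : V -> W) : Prop :=
  match k with
  | 0 => forall x, U x -> {for x, continuous f}
  | k'.+1 => (forall x, U x -> differentiable f x) /\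
             (forall v : V, Ck_on k' U ('D_v f))
  end.

Definition smooth_on {R : realType} {V W : normedModType R} (U : set V)
    (f : V -> W) : Prop :=
  forall k, Ck_on k U f.

(* Smoothness of f : A -> B for arbitrary subsets of normed spaces: f extends  *)
(* locally to a smooth map on an open set.  When A and B are embedded smooth   *)
(* submanifolds this is smoothness for the submanifold structures.             *)
(* Values of f outside A are irrelevant.                                       *)
Definition smooth_map {R : realType} {V W : normedModType R} (A : set V)
    (B : set W) (f : V -> W) : Prop :=
  (forall x, A x -> B (f x)) /\
  (forall x, A x -> exists (U : set V) (F : V -> W),
     [/\ open U, U x, smooth_on U F & forall y, A y -> U y -> F y = f y]).

Definition diffeomorphic {R : realType} {V W : normedModType R} (A : set V)
    (B : set W) : Prop :=
  exists (f : V -> W) (g : W -> V),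
    [/\ smooth_map A B f, smooth_map B A g,
        forall x, A x -> g (f x) = x & forall y, B y -> f (g y) = y].

Definition arrow_mx {C : nzRingType} {n : nat} (A : 'M[C]_n.+1) : Prop :=
  forall i j : 'I_n.+1, i != j -> i != ord0 -> j != ord0 -> A i j = 0.

Definition hermitian_arrow {R : realType} {n : nat} : set 'M[R[i]]_n.+1 :=
  [set A | A \is hermsymmx /\ arrow_mx A].

Definition spectrum {F : fieldType} {n : nat} (A : 'M[F]_n) : set F :=
  [set z | eigenvalue A z].

Definition isospectral_arrow {R : realType} {n : nat} (lam : 'I_n.+1 -> R) :
    set 'M[R[i]]_n.+1 :=
  [set A | hermitian_arrow A /\ spectrum A = range (fun i => (lam i)%:C)].

(* The real-linear isomorphism from the Hermitian arrow matrices to            *)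
(* R^(n+1) x C^n, with C^n written R^n x R^n: the (real) diagonal, then the    *)
(* real and imaginary parts of the entries of row 0 off the diagonal.          *)
Definition arrow_coord {R : realType} {n : nat} (A : 'M[R[i]]_n.+1) :
    'rV[R]_n.+1 * ('rV[R]_n * 'rV[R]_n) :=
  (\row_(i < n.+1) complex.Re (A i i),
   (\row_(j < n) complex.Re (A ord0 (lift ord0 j)),
    \row_(j < n) complex.Im (A ord0 (lift ord0 j)))).

Lemma hermitianE {R : realType} {n : nat} (A : 'M[R[i]]_n.+1) :
  A \is hermsymmx <-> forall i j, A i j = (A j i)^*.
Proof.
split=> [/is_hermitianmxP h i j|h].
  by rewrite {1}h expr0 scale1r !mxE.
apply/is_hermitianmxP/matrixP => i j.
by rewrite expr0 scale1r !mxE h.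
Qed.

Lemma arrow_coord_bij (R : realType) (n : nat) :
  set_bij (@hermitian_arrow R n) setT arrow_coord.
Proof.
split=> //.
- move=> A B /set_mem[/hermitianE hA aA] /set_mem[/hermitianE hB aB].
  move=> /pair_equal_spec[/rowP d] /pair_equal_spec[/rowP x /rowP y].
  have E0 j : A ord0 (lift ord0 j) = B ord0 (lift ord0 j).
    by apply/eqP; rewrite eq_complex; move: (x j) (y j); rewrite !mxE => -> ->;
       rewrite !eqxx.
  have ImD (M : 'M[R[i]]_n.+1) i : (forall i j, M i j = (M j i)^*) ->
      complex.Im (M i i) = 0.
    move=> /(_ i i); case: (M i i) => a b [] /= /eqP.
    by rewrite -subr_eq0 opprK -mulr2n mulrn_eq0 => /eqP.
  apply/matrixP => i j; have [->|ij] := eqVneq i j.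
    apply/eqP; rewrite eq_complex !ImD// eqxx andbT.
    by move: (d j); rewrite !mxE => ->.
  case: (unliftP ord0 i) ij => [i' ->|->]; case: (unliftP ord0 j) => [j' ->|->] ij //.
  + by rewrite aA ?aB.
  + by rewrite hA hB E0.
- move=> [d [x y]] _.
  pose z (j : 'I_n) : R[i] := x 0 j +i* y 0 j.
  pose M : 'M[R[i]]_n.+1 := \matrix_(i, j)
    if i == j then (d 0 i)%:C else
    match unlift ord0 i, unlift ord0 j with
    | None, Some j' => z j'
    | Some i', None => (z i')^*
    | _, _ => 0
    end.
  have zJ (w : R[i]) : w^*^* = w by case: w => a b /=; rewrite opprK.
  exists M.
    split; first apply/hermitianE => i j.
      rewrite !mxE eq_sym; case: eqVneq => [->|_].
        by rewrite /= oppr0.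
      by case: (unlift ord0 i) => [i'|]; case: (unlift ord0 j) => [j'|];
         rewrite ?zJ ?conjc0.
    move=> i j ij i0 j0; rewrite mxE (negPf ij).
    case: unliftP i0 => [i' _ _|-> //].
    by case: unliftP j0 => [|->].
  rewrite /arrow_coord; congr (_, (_, _)); apply/rowP => j; rewrite !mxE.
  + by rewrite eqxx.
  + by rewrite (negPf (neq_lift _ _)) unlift_none liftK.
  + by rewrite (negPf (neq_lift _ _)) unlift_none liftK.
Qed.

Lemma arrow_coord_linear (R : realType) (n : nat) (r : R) (A B : 'M[R[i]]_n.+1) :
  arrow_coord (r%:C *: A + B) = r *: arrow_coord A + arrow_coord B.
Proof.
rewrite /arrow_coord; congr (_, (_, _)); apply/rowP => j; rewrite !mxE.
- by case: (A j j) (B j j) => [a b] [c d] /=; rewrite mul0r subr0.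
- by case: (A _ _) (B _ _) => [a b] [c d] /=; rewrite mul0r subr0.
- by case: (A _ _) (B _ _) => [a b] [c d] /=; rewrite mul0r addr0.
Qed.

(* Main.v *)
Require Import Defs.
From HB Require Import structures.
From mathcomp Require Import all_boot all_order all_algebra.
From mathcomp Require Import all_classical all_reals all_analysis.
From mathcomp Require Import complex polyrcf ring lra.

Set Implicit Arguments.
Unset Strict Implicit.
Unset Printing Implicit Defensive.

Import Order.TTheory GRing.Theory Num.Theory.
Import numFieldNormedType.Exports.

Local Open Scope classical_set_scope.
Local Open Scope ring_scope.

(** Let [d] be the diagonal of an arrow matrix, [a] its part below the corner,
    [z] the entries of row 0 off the diagonal, [w i = |z i|^2],
    [Q = \prod_i ('X - a i)] and [N = \prod_k ('X - lam k)]. The characteristic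
    polynomial is
    [\prod_k ('X - d k) - \sum_i w i \prod_(j != i) ('X - a j)], so the spectrum
    is [lam] exactly when the trace is [\sum_k lam k] and [Q] divides
    [N + \sum_i w i \prod_(j != i) ('X - a j)] ([isospectral_arrowE]).

    There is a polynomial [phi] with [phi (lam k) = lam' k] whose derivative is
    bounded below by a positive constant ([monotone_interpolation]); it is a
    bijection of the line. The diffeomorphism sends [a i] to [phi (a i)] and
    [z i] to [sqrt (r i) * z i], with
    [r i = \prod_k phi[a i, lam k] / \prod_(j != i) phi[a i, a j]], where
    [phi[x, y] = (phi x - phi y) / (x - y)] is the divided difference; the
    corner entry is then given by the trace. Divided differences of [phi] are
    polynomials in both arguments, positive everywhere since [phi' > 0], also on
    the diagonal; hence the map is smooth, even where some of the [a i]
    coincide. That it preserves the divisibility condition follows from a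
    congruence modulo [Q] after composition with [phi] ([dvdp_weight_ratio]),
    and the same equivalence read backwards applies to the inverse map, which is
    smooth because the inverse function of [phi] is.

    Both maps are restrictions of maps smooth on the whole space of coordinates,
    so only smoothness on [setT] has to be treated. *)

(** * Smooth maps on a normed space *)

Section Smooth.
Context {R : realType} {V : normedModType R}.
Implicit Types (k : nat) (W : normedModType R).

Lemma Ck_onW W k (U : set V) (f : V -> W) : Ck_on k.+1 U f -> Ck_on k U f.
Proof.
elim: k f => [|k IH] f [df Df].
  by move=> x /df; apply: differentiable_continuous.
by split=> // v; apply: IH (Df v).
Qed.

Lemma Ck_on_cst W k (U : set V) (c : W) : Ck_on k U (cst c : V -> W).
Proof.
elim: k c => [|k IH] c; first by move=> x _; apply: cvg_cst.
split=> [x _|v]; first exact: differentiable_cst.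
rewrite (_ : 'D_v _ = cst 0) //; apply/funext => x.
exact: derive_cst.
Qed.

Lemma Ck_on_linear W k (f : V -> W) :
  linear f -> continuous f -> Ck_on k setT f.
Proof.
move=> lf cf; pose fM := GRing.isLinear.Build _ _ _ _ _ lf.
pose L : {linear V -> W} := HB.pack f fM.
have dL x : differentiable L x by exact: linear_differentiable.
rewrite -[f]/(L : V -> W); case: k => [|k]; first by move=> x _; apply: cf.
split=> // v; rewrite (_ : 'D_v _ = cst (L v)); first exact: Ck_on_cst.
by apply/funext => x; rewrite deriveE ?diff_lin.
Qed.

Lemma Ck_onD W k (f g : V -> W) :
  Ck_on k setT f -> Ck_on k setT g -> Ck_on k setT (f + g).
Proof.
elim: k f g => [|k IH] f g.
  by move=> cf cg x _; apply: cvgD; [apply: cf|apply: cg].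
move=> [df Df] [dg Dg]; split=> [x _|v].
  by apply: differentiableD; [apply: df|apply: dg].
rewrite (_ : 'D_v _ = 'D_v f + 'D_v g); first exact: IH (Df v) (Dg v).
by apply/funext => x; apply: deriveD; apply: diff_derivable;
  [apply: df|apply: dg].
Qed.

Lemma Ck_onM k (f g : V -> R) :
  Ck_on k setT f -> Ck_on k setT g -> Ck_on k setT (f * g).
Proof.
elim: k f g => [|k IH] f g.
  by move=> cf cg x _; apply: cvgM; [apply: cf|apply: cg].
move=> Cf Cg; have [df Df] := Cf; have [dg Dg] := Cg; split=> [x _|v].
  by apply: differentiableM; [apply: df|apply: dg].
rewrite (_ : 'D_v _ = f * 'D_v g + g * 'D_v f).
  by apply: Ck_onD; apply: IH; do ?[exact: Df|exact: Dg|exact: Ck_onW].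
by apply/funext => x; apply: deriveM; apply: diff_derivable;
  [apply: df|apply: dg].
Qed.

Lemma Ck_onZl W k (f : V -> R) (w : W) :
  Ck_on k setT f -> Ck_on k setT (fun x => f x *: w).
Proof.
elim: k f => [|k IH] f.
  by move=> cf x _; apply: cvgZr_tmp; apply: cf.
move=> [df Df]; split=> [x _|v]; first by apply: differentiableZl; apply: df.
rewrite (_ : 'D_v _ = fun x => 'D_v f x *: w); first exact: IH (Df v).
apply/funext => x; have dfx := df x I; rewrite (deriveE _ dfx).
by rewrite deriveE ?diffZl//; apply: differentiableZl.
Qed.

Lemma derive_comp1 (h : R -> R) (f : V -> R) (l : R) (x v : V) :
  differentiable f x -> is_derive (f x) 1 h l ->
  differentiable (h \o f) x /\ 'D_v (h \o f) x = l * 'D_v f x.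
Proof.
move=> df [dh <-].
have Dh : differentiable h (f x) by apply/derivable1_diffP.
split; first exact: differentiable_comp.
rewrite !deriveE//; last exact: differentiable_comp.
rewrite diff_comp//=.
by rewrite -[in LHS](mulr1 ('d f x v)) -[_ * 1]/(_ *: _) linearZ/= mulrC.
Qed.

(** A function with [h' = H o h] is as smooth as [H]: the derivative of [h o f]
    is [(H o h o f) * f'], so each order of differentiability of [h o f] yields
    the next. Inverses, square roots and inverse functions are of this kind. *)
Lemma Ck_on_comp_ode k (h H : R -> R) (f : V -> R) :
  (forall x, is_derive (f x) 1 h (H (h (f x)))) ->
  (forall j, Ck_on j setT (h \o f) -> Ck_on j setT (H \o (h \o f))) ->
  Ck_on k setT f -> Ck_on k setT (h \o f).
Proof.
move=> dh HC; elim: k => [|k IH].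
  move=> cf x _; apply: continuous_comp; first exact: cf.
  have [dhx _] := dh x.
  by apply: differentiable_continuous; apply/derivable1_diffP.
move=> Cf; have [df Df] := Cf; split=> [x _|v].
  by have [] := derive_comp1 0 (df x I) (dh x).
rewrite (_ : 'D_v _ = (H \o (h \o f)) * 'D_v f).
  by apply: Ck_onM; [apply/HC/IH; exact: Ck_onW|exact: Df].
by apply/funext => x; have [_ ->] := derive_comp1 v (df x I) (dh x).
Qed.

Lemma Ck_onX k n (f : V -> R) :
  Ck_on k setT f -> Ck_on k setT (fun x => f x ^+ n).
Proof.
move=> Cf; elim: n => [|n IH]; first exact: Ck_on_cst.
rewrite (_ : (fun _ => _) = f * (fun x => f x ^+ n)); first exact: Ck_onM.
by apply/funext => x; rewrite exprS.
Qed.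

Lemma Ck_on_sum (I : Type) (r : seq I) (P : pred I) W k (F : I -> V -> W) :
  (forall i, Ck_on k setT (F i)) ->
  Ck_on k setT (fun x => \sum_(i <- r | P i) F i x).
Proof.
move=> CF; rewrite (_ : (fun _ => _) = \sum_(i <- r | P i) F i); last first.
  by apply/funext => x; rewrite fct_sumE.
by elim/big_ind: _ => // *; [exact: Ck_on_cst|exact: Ck_onD].
Qed.

Lemma Ck_on_prod (I : Type) (r : seq I) (P : pred I) k (F : I -> V -> R) :
  (forall i, Ck_on k setT (F i)) ->
  Ck_on k setT (fun x => \prod_(i <- r | P i) F i x).
Proof.
move=> CF; rewrite (_ : (fun _ => _) = \prod_(i <- r | P i) F i); last first.
  by apply/funext => x; rewrite fct_prodE.
by elim/big_ind: _ => // *; [exact: Ck_on_cst|exact: Ck_onM].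
Qed.

Lemma Ck_on_horner k (p : {poly R}) (f : V -> R) :
  Ck_on k setT f -> Ck_on k setT (fun x => p.[f x]).
Proof.
move=> Cf; rewrite (_ : (fun _ => _) =
    fun x => \sum_(i < size p) (cst p`_i * (fun y => f y ^+ i)) x); last first.
  by apply/funext => x; rewrite horner_coef.
apply: Ck_on_sum => i; apply: Ck_onM; first exact: Ck_on_cst.
exact: Ck_onX.
Qed.

Lemma Ck_on_inv k (f : V -> R) : (forall x, f x != 0) ->
  Ck_on k setT f -> Ck_on k setT (fun x => (f x)^-1).
Proof.
move=> f0 Cf; apply: (@Ck_on_comp_ode _ GRing.inv (fun y => - y ^+ 2)) => //.
  move=> x; split; first by apply/derivable1_diffP/differentiable_Rinv/f0.
  have := @deriveV _ _ id (f x) 1 (f0 x); rewrite derive_id => ->.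
    by rewrite /GRing.scale/= mulr1 exprVn.
  by have [] := is_derive_id (f x) (1 : R).
move=> j Cg; rewrite (_ : _ \o _ = cst (-1) * (fun x => (f x)^-1 ^+ 2)).
  by apply: Ck_onM; [exact: Ck_on_cst|exact: Ck_onX].
by apply/funext => x; rewrite /= /GRing.mul/= mulN1r.
Qed.

Lemma Ck_on_sqrt k (f : V -> R) : (forall x, 0 < f x) ->
  Ck_on k setT f -> Ck_on k setT (fun x => Num.sqrt (f x)).
Proof.
move=> f0 Cf; apply: (@Ck_on_comp_ode _ Num.sqrt (fun y => (2 * y)^-1)) => //.
  by move=> x; apply: is_derive1_sqrt.
move=> j Cg; apply: Ck_on_inv.
  by move=> x /=; rewrite mulf_neq0 ?pnatr_eq0// gt_eqF// sqrtr_gt0.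
by apply: Ck_onM => //; exact: Ck_on_cst.
Qed.

Lemma Ck_on_pair (W1 W2 : normedModType R) k (f : V -> W1) (g : V -> W2) :
  Ck_on k setT f -> Ck_on k setT g -> Ck_on k setT (fun x => (f x, g x)).
Proof.
elim: k f g => [|k IH] f g.
  by move=> cf cg x _; apply: cvg_pair; [apply: cf|apply: cg].
move=> [df Df] [dg Dg]; split=> [x _|v].
  by apply: differentiable_pair; [apply: df|apply: dg].
rewrite (_ : 'D_v _ = fun x => ('D_v f x, 'D_v g x)).
  exact: IH (Df v) (Dg v).
apply/funext => x; have dfx := df x I; have dgx := dg x I.
rewrite (deriveE _ dfx) (deriveE _ dgx) deriveE ?diff_pair//.
exact: differentiable_pair.
Qed.

Lemma Ck_on_row k m (f : 'I_m -> V -> R) :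
  (forall j, Ck_on k setT (f j)) -> Ck_on k setT (fun x => \row_j f j x).
Proof.
move=> Cf; rewrite (_ : (fun _ => _) =
    fun x => \sum_j f j x *: (delta_mx 0 j : 'rV[R]_m)).
  by apply: Ck_on_sum => j; apply: Ck_onZl.
apply/funext => x; rewrite [LHS]row_sum_delta.
by apply: eq_bigr => j _; rewrite mxE.
Qed.

End Smooth.

(** * Divided differences and divisibility *)

Section RootProducts.
Context {F : fieldType}.

Definition prodX (I : finType) (a : I -> F) : {poly F} :=
  \prod_i ('X - (a i)%:P).

(** The characteristic polynomial of an arrow matrix with diagonal [d], lower
    diagonal [a] and squared off-diagonal norms [w] is
    [prodX d - omit_sum a w]. *)
Definition omit_sum (I : finType) (a w : I -> F) : {poly F} :=
  \sum_i w i *: \prod_(j | j != i) ('X - (a j)%:P).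

Lemma root_prodX (I : finType) (a : I -> F) x :
  root (prodX a) x = [exists i, x == a i].
Proof.
rewrite /root horner_prod prodf_seq_eq0.
apply/hasP/existsP => [[i _]|[i /eqP->]].
  by rewrite !hornerE subr_eq0 => ?; exists i.
by exists i; rewrite ?mem_index_enum// !hornerE subrr.
Qed.

Lemma size_prodXB (m : nat) (a b : 'I_m.+1 -> F) :
  (size (prodX a - prodX b)%R <= m)%N = (\sum_k a k == \sum_k b k).
Proof.
have sz (c : 'I_m.+1 -> F) : size (prodX c) = m.+2.
  by rewrite size_prod_XsubC /index_enum -enumT size_enum_ord.
have cf (c : 'I_m.+1 -> F) : (prodX c)`_m.+1 = 1 /\ (prodX c)`_m = - \sum_k c k.
  split.
    have /monicP : prodX c \is monic by exact: monic_prod_XsubC.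
    by rewrite lead_coefE sz.
  have := @coefPn_prod_XsubC F (codom c).
  by rewrite size_codom card_ord !big_image => -> .
have [a1 a0] := cf a; have [b1 b0] := cf b.
apply/idP/eqP => [sab|ab].
  apply/eqP; rewrite -eqr_opp -a0 -b0 -subr_eq0 -coefB; apply/eqP.
  by rewrite nth_default.
apply/leq_sizeP => j; rewrite leq_eqVlt => /orP[/eqP<-|].
  by rewrite coefB a0 b0 ab subrr.
rewrite leq_eqVlt => /orP[/eqP<-|mj]; first by rewrite coefB a1 b1 subrr.
by rewrite coefB !nth_default ?subrr ?sz.
Qed.

End RootProducts.

Lemma coprimep_prod_XsubC (F : fieldType) (I : Type) (s : seq I) (P : pred I)
    (a : I -> F) (p : {poly F}) :
  (forall i, ~~ root p (a i)) ->
  coprimep (\prod_(i <- s | P i) ('X - (a i)%:P)) p.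
Proof.
move=> pa; elim/big_ind: _ => [|u v cu cv|i _]; first exact: coprime1p.
  by rewrite coprimepMl cu.
by rewrite coprimep_sym coprimep_XsubC.
Qed.

Section DividedDifference.
Context {F : fieldType}.
Implicit Types (p q : {poly F}) (a b : F).

(** The divided difference [p[X, b] = (p(X) - p(b)) / (X - b)], written out in
    the powers of [b] so that it visibly depends polynomially on [b] too. *)
Definition ddiff p b : {poly F} :=
  \sum_(m < size p) p`_m *: \sum_(l < m) 'X^(m.-1 - l) * b%:P ^+ l.

Lemma ddiffE p b : p - p.[b]%:P = ('X - b%:P) * ddiff p b.
Proof.
rewrite -{1}[p]coefK poly_def horner_coef rmorph_sum /= -sumrB mulr_sumr.
apply: eq_bigr => m _; rewrite -scalerAr -subrXX scalerBr.
by rewrite rmorphM rmorphXn/= mul_polyC.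
Qed.

Lemma horner_ddiff p a b : p.[a] - p.[b] = (a - b) * (ddiff p b).[a].
Proof. by have /(congr1 (horner^~ a)) := ddiffE p b; rewrite !hornerE. Qed.

Lemma ddiff_diag p a : (ddiff p a).[a] = p^`().[a].
Proof.
have /(congr1 (fun q => q^`().[a])) := ddiffE p a.
rewrite derivM !derivB derivX !derivC !hornerE.
by rewrite subrr mul0r addr0 !subr0 mul1r => <-.
Qed.

Lemma comp_XsubC p b : ('X - p.[b]%:P) \Po p = ('X - b%:P) * ddiff p b.
Proof. by rewrite comp_polyB comp_polyX comp_polyC ddiffE. Qed.

Lemma horner_ddiff_sum p a b : (ddiff p b).[a] = \sum_(m < size p) p`_m *
   \sum_(l < m) a ^+ (m.-1 - l) * b ^+ l.
Proof.
rewrite horner_sum; apply: eq_bigr => m _; rewrite hornerZ horner_sum.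
by congr (_ * _); apply: eq_bigr => l _; rewrite !hornerE.
Qed.

Variable phi : {poly F}.
Hypothesis phi_neq0 : forall a b, (ddiff phi b).[a] != 0.

(** Multiplicities of roots are preserved because [phi(X) - phi(a)] is [X - a]
    times a polynomial without roots. *)
Lemma dvdp_comp_prod_XsubC (I : Type) (s : seq I) (a : I -> F) (H : {poly F}) :
  (\prod_(i <- s) ('X - (a i)%:P) %| H \Po phi) =
  (\prod_(i <- s) ('X - phi.[a i]%:P) %| H).
Proof.
apply/idP/idP; last first.
  move=> /dvdpP[q ->]; rewrite comp_polyM dvdp_mull// rmorph_prod/=.
  elim/big_ind2: _ => // [u v u' v'|i _]; first exact: dvdp_mul.
  by rewrite comp_XsubC dvdp_mulr.
elim: s H => [|i s IH] H; first by rewrite !big_nil !dvd1p.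
rewrite !big_cons => dH.
have : root H phi.[a i].
  have /(dvdp_trans (dvdp_mulr _ (dvdpp _))) := dH.
  by rewrite dvdp_XsubCl /root horner_comp.
rewrite -dvdp_XsubCl => /dvdpP[K HK]; move: dH.
rewrite HK comp_polyM comp_XsubC mulrCA dvdp_mul2l ?polyXsubC_eq0//.
rewrite [_ * ('X - _)]mulrC dvdp_mul2l ?polyXsubC_eq0// => dK.
apply: IH; move: dK; rewrite Gauss_dvdpl//.
by apply: coprimep_prod_XsubC => j; apply: phi_neq0.
Qed.

(** For distinct [a i] the squared off-diagonal norm of an arrow matrix with
    spectrum [lam] is
    [w i = - \prod_k (a i - lam k) / \prod_(j != i) (a i - a j)]. Applying
    [phi] to all [a i] and [lam k] multiplies this by [weight_ratio], which
    still makes sense when some of the [a i] coincide. *)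
Definition weight_ratio (I K : finType) (a : I -> F) (lam : K -> F) (i : I) :=
  (\prod_k (ddiff phi (lam k)).[a i]) /
  (\prod_(j | j != i) (ddiff phi (a j)).[a i]).

(** Composing the polynomial on the left with [phi] yields
    [P * (prodX lam + omit_sum a w)] up to multiples of [prodX a], where [P] has
    no root: in the [i]-th summand of the error the product omits only
    ['X - a i], and its cofactor vanishes at [a i] by the choice of
    [weight_ratio]. *)
Lemma dvdp_weight_ratio (I K : finType) (a w : I -> F) (lam : K -> F) :
  (prodX (fun i => phi.[a i]) %| prodX (fun k => phi.[lam k]) +
     omit_sum (fun i => phi.[a i]) (fun i => weight_ratio a lam i * w i)) =
  (prodX a %| prodX lam + omit_sum a w).
Proof.
rewrite -dvdp_comp_prod_XsubC -/(prodX a).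
set P : {poly F} := \prod_k ddiff phi (lam k).
pose D i : {poly F} := \prod_(j | j != i) ddiff phi (a j).
have compP (J : finType) (Q : pred J) (b : J -> F) :
  (\prod_(j | Q j) ('X - phi.[b j]%:P)) \Po phi =
  (\prod_(j | Q j) ('X - (b j)%:P)) * \prod_(j | Q j) ddiff phi (b j).
  rewrite rmorph_prod -big_split/=; apply: eq_bigr => j _; exact: comp_XsubC.
have -> : (prodX (fun k => phi.[lam k]) +
     omit_sum (fun i => phi.[a i]) (fun i => weight_ratio a lam i * w i)) \Po phi
   = P * (prodX lam + omit_sum a w) + \sum_i
      w i *: (\prod_(j | j != i) ('X - (a j)%:P) *
               (weight_ratio a lam i *: D i - P)).
  rewrite comp_polyD compP mulrDr mulrC -addrA; congr (_ + _).
  rewrite rmorph_sum/= mulr_sumr -big_split/=; apply: eq_bigr => i _.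
  rewrite comp_polyZ compP -/(D i) -!mul_polyC !rmorphM/=; ring.
rewrite dvdp_addl; last first.
  elim/big_ind: _ => [|u v|i _]; [exact: dvdp0|exact: dvdp_add|].
  have [->|w0] := eqVneq (w i) 0; first by rewrite scale0r dvdp0.
  rewrite dvdpZr// /prodX (bigD1 i)//= mulrC dvdp_mul//.
  rewrite dvdp_XsubCl /root !hornerE !horner_prod /weight_ratio subr_eq0.
  by rewrite divfK//; apply/prodf_neq0 => j _; apply: phi_neq0.
rewrite Gauss_dvdpr//.
apply: coprimep_prod_XsubC => i; rewrite /root horner_prod.
by apply/prodf_neq0 => k _; apply: phi_neq0.
Qed.

End DividedDifference.

(** * Monotone polynomial interpolation *)

Section Interpolation.
Context {R : realType}.

(** The constant coefficient is [p`_0 / 0 = 0]. *)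
Definition primitive (p : {poly R}) : {poly R} :=
  \poly_(i < (size p).+1) (p`_i.-1 / i%:R).

Lemma deriv_primitive p : (primitive p)^`() = p.
Proof.
apply/polyP => i; rewrite coef_deriv coef_poly ltnS /=.
case: ltnP => ip; last by rewrite mul0rn nth_default.
by rewrite -[LHS]mulr_natr divfK// pnatr_eq0.
Qed.

Lemma poly_incr_homo (p : {poly R}) : (forall x, 0 < p^`().[x]) ->
  {homo horner p : x y / x < y}.
Proof.
move=> p0 x y xy; have [c _ E] := poly_mvt p xy.
by rewrite -subr_gt0 E mulr_gt0// subr_gt0.
Qed.

Lemma exists_expr_lt (z e : R) : 0 <= z -> z < 1 -> 0 < e ->
  exists N, z ^+ N < e.
Proof.
move=> z0 z1 e0.
have /cvgr0Pnorm_lt/(_ _ e0)[N _ /(_ N)/=] : @GRing.exp R z @ \oo --> (0 : R).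
  by apply: cvg_expr; rewrite ger0_norm.
by rewrite leqnn ger0_norm ?exprn_ge0// => /(_ isT) ?; exists N.
Qed.

(** The antiderivative of a high power of [q = 1 + (L^2 - (X - mu)^2)^2], where
    [mu] is the midpoint of the chosen interval: as long as [|x - mu| <= L],
    [q] strictly decreases with the distance to [mu], so its powers concentrate
    around [mu]. The summand [1] keeps the derivative away from [0] on the
    whole line. *)
Lemma concentrated_poly (I : finType) (l u : I -> R) (k : I) (e : R) :
  0 < e -> (forall j, l j < u j) ->
  (forall j, j != k -> u j <= l k \/ u k <= l j) ->
  exists p : {poly R}, [/\ exists2 c, 0 < c & forall x, c <= p^`().[x],
    p.[u k] - p.[l k] = 1 & forall j, j != k -> `|p.[u j] - p.[l j]| <= e].
Proof.
move=> e0 lu sep.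
pose mu := (l k + u k) / 2; pose h := (u k - l k) / 2.
have luk := lu k.
have h0 : 0 < h by rewrite divr_gt0// subr_gt0.
pose L := \sum_j (`|l j - mu| + `|u j - mu|).
have Lj j : `|l j - mu| <= L /\ `|u j - mu| <= L.
  rewrite /L (bigD1 j)//=; set S := \sum_(i | _) _.
  have S0 : 0 <= S by apply: sumr_ge0 => i _; rewrite addr_ge0.
  have := normr_ge0 (l j - mu); have := normr_ge0 (u j - mu).
  by split; lra.
have hL : h <= L.
  have [_] := Lj k; rewrite (_ : u k - mu = h) ?gtr0_norm//.
  by rewrite /h /mu; field.
pose q : {poly R} := 1 + ((L ^+ 2)%:P - ('X - mu%:P) ^+ 2) ^+ 2.
have qE x : q.[x] = 1 + (L ^+ 2 - (x - mu) ^+ 2) ^+ 2 by rewrite !hornerE.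
have q1 x : 1 <= q.[x] by rewrite qE lerDl sqr_ge0.
(* [r1] bounds [q] on the other intervals, [r2] on the middle half of the
   chosen one. *)
pose r1 := 1 + (L ^+ 2 - h ^+ 2) ^+ 2.
pose r2 := 1 + (L ^+ 2 - (h / 2) ^+ 2) ^+ 2.
have r1_gt0 : 0 < r1 by rewrite /r1 ltr_pwDl// sqr_ge0.
have r12 : r1 < r2.
  rewrite ltrD2l ltr_pXn2r ?nnegrE//; nra.
have far j x : j != k -> x \in `[l j, u j] -> q.[x] <= r1.
  move=> jk /itvP xlu; have [] := Lj j.
  rewrite !ler_norml => /andP[a1 a2] /andP[b1 b2].
  have [xl xu] : l j <= x /\ x <= u j by rewrite !xlu.
  have lE : l k = mu - h by rewrite /mu /h; field.
  have uE : u k = mu + h by rewrite /mu /h; field.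
  have t1 : h ^+ 2 <= (x - mu) ^+ 2.
    by have [|] := sep j jk; rewrite ?lE ?uE => ?; nra.
  have t2 : (x - mu) ^+ 2 <= L ^+ 2 by nra.
  by rewrite qE /r1 lerD2l ler_pXn2r ?nnegrE//; lra.
have near_mu x : x \in `[mu - h / 2, mu + h / 2] -> r2 <= q.[x].
  move=> /itvP xlu.
  have [xl xu] : mu - h / 2 <= x /\ x <= mu + h / 2 by rewrite !xlu.
  have t1 : (x - mu) ^+ 2 <= (h / 2) ^+ 2 by nra.
  have t2 : (h / 2) ^+ 2 <= L ^+ 2 by nra.
  by rewrite qE /r2 lerD2l ler_pXn2r ?nnegrE//; lra.
pose M := (\sum_j (u j - l j)) / h.
have [N NM] : exists N, (r1 / r2) ^+ N < e / (M + 1).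
  apply: exists_expr_lt; first by rewrite divr_ge0// ltW// (lt_trans r1_gt0).
    by rewrite ltr_pdivrMr ?mul1r// (lt_trans r1_gt0).
  rewrite divr_gt0// ltr_wpDl// divr_ge0 ?(ltW h0)// sumr_ge0// => j _.
  by rewrite subr_ge0 ltW.
pose S := primitive (q ^+ N).
have dS x : S^`().[x] = q.[x] ^+ N by rewrite deriv_primitive horner_exp.
have dS1 x : 1 <= S^`().[x] by rewrite dS exprn_ege1.
have Sincr : {homo horner S : x y / x < y}.
  by apply: poly_incr_homo => x; apply: lt_le_trans (dS1 x).
have Sk : r2 ^+ N * h <= S.[u k] - S.[l k].
  have lk : l k <= mu - h / 2 by rewrite /mu /h; lra.
  have uk : mu + h / 2 <= u k by rewrite /mu /h; lra.
  have mid : mu - h / 2 < mu + h / 2 by lra.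
  have [c clu E] := poly_mvt S mid.
  have : r2 ^+ N * h <= S.[mu + h / 2] - S.[mu - h / 2].
    rewrite E dS (_ : mu + h / 2 - (mu - h / 2) = h); last by field.
    rewrite ler_pM2r// lerXn2r ?nnegrE ?(le_trans ler01 (q1 _)) ?near_mu//.
    + by rewrite /r2 addr_ge0// sqr_ge0.
    + exact: subset_itv_oo_cc clu.
  have := ltW_homo Sincr lk; have := ltW_homo Sincr uk; lra.
have Sk0 : 0 < S.[u k] - S.[l k] by rewrite subr_gt0 Sincr.
exists ((S.[u k] - S.[l k])^-1 *: S); split.
- exists (S.[u k] - S.[l k])^-1; first by rewrite invr_gt0.
  by move=> x; rewrite derivZ hornerZ ler_peMr// invr_ge0 ltW.
- by rewrite !hornerZ -mulrBr mulVf// gt_eqF.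
move=> j jk; rewrite !hornerZ -mulrBr normrM.
rewrite !gtr0_norm ?invr_gt0// ?subr_gt0 ?Sincr//.
rewrite mulrC ler_pdivrMr//.
have [c clu ->] := poly_mvt S (lu j).
have uj : 0 < u j - l j by rewrite subr_gt0.
have qc : q.[c] ^+ N <= r1 ^+ N.
  rewrite lerXn2r ?nnegrE ?(le_trans ler01 (q1 _)) ?(ltW r1_gt0)//.
  by apply: far jk _; exact: subset_itv_oo_cc clu.
have jM : u j - l j <= (M + 1) * h.
  rewrite mulrDl mul1r /M divfK ?gt_eqF// (bigD1 j)//=.
  have : 0 <= \sum_(i | i != j) (u i - l i).
    by apply: sumr_ge0 => i _; rewrite subr_ge0 ltW.
  lra.
have M1 : 0 < M + 1 by rewrite -(pmulr_lgt0 _ h0); apply: lt_le_trans jM.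
have r2N : 0 < r2 ^+ N by rewrite exprn_gt0// (lt_trans r1_gt0).
move: NM; rewrite expr_div_n ltr_pdivrMr// mulrAC ltr_pdivlMr// => /ltW NM.
rewrite dS; apply: le_trans (ler_wpM2r (ltW uj) qc) _.
apply: le_trans (ler_wpM2l (exprn_ge0 _ (ltW r1_gt0)) jM) _.
rewrite mulrA; apply: le_trans (ler_wpM2r (ltW h0) NM) _.
by rewrite -mulrA ler_pM2l.
Qed.

(** Off-diagonal entries this small make [M] close to the identity, so the
    solution [c] of [c *m M = d] inherits the positivity of [d]. *)
Lemma near_identity_pos_solution (n : nat) (d : 'I_n -> R) :
  (forall j, 0 < d j) -> exists2 e : R, 0 < e & forall M : 'M[R]_n,
    (forall k, M k k = 1) -> (forall k j, j != k -> `|M k j| <= e) ->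
    exists2 c : 'I_n -> R, forall k, 0 < c k &
      forall j, \sum_k c k * M k j = d j.
Proof.
move=> d0; pose D := \sum_j d j.
have [m m0 md] : exists2 m, 0 < m & forall j, m <= d j.
  exists (\big[Order.min/1]_j d j); first by apply/lt_bigmin.
  by move=> j; apply: bigmin_le.
have D0 : 0 <= D by apply: sumr_ge0 => j _; rewrite ltW.
pose e := Num.min (2 * (n%:R + 1))^-1 (m / (4 * (D + 1))).
have e0 : 0 < e.
  by rewrite lt_min invr_gt0 divr_gt0// mulr_gt0// ltr_wpDl.
exists e => // M M1 Me.
have ne : n%:R * e <= 1 / 2.
  apply: (@le_trans _ _ (n%:R * (2 * (n%:R + 1))^-1)).
    by rewrite ler_wpM2l// ge_min lexx.
  by rewrite ler_pdivrMr; have := ler0n R n; lra.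
have eD : e * (2 * D) < m.
  have : e <= m / (4 * (D + 1)) by rewrite ge_min lexx orbT.
  rewrite ler_pdivlMr; last by lra.
  nra.
(* In the l1 norm, the off-diagonal part of [M] shrinks by [n * e <= 1/2]. *)
have est (c v : 'rV[R]_n) : c *m M = v ->
    \sum_j `|c 0 j| <= 2 * \sum_j `|v 0 j| /\
    forall j, `|c 0 j - v 0 j| <= e * \sum_j `|c 0 j|.
  move=> cv; set C := \sum_j `|c 0 j|.
  have cj j : `|c 0 j - v 0 j| <= e * C.
    rewrite -cv mxE (bigD1 j)//= M1 mulr1 opprD addNKr normrN.
    rewrite mulr_sumr [leRHS](bigD1 j)//=.
    apply: le_trans (ler_norm_sum _ _ _) _.
    apply: ler_wpDl; first by rewrite mulr_ge0// ltW.
    apply: ler_sum => k kj; rewrite normrM mulrC ler_wpM2r//.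
    by apply: Me; rewrite eq_sym.
  split=> //.
  have : C <= \sum_j (`|v 0 j| + e * C).
    apply: ler_sum => j _; rewrite -lerBlDl; apply: le_trans (cj j).
    exact: lerB_dist.
  rewrite big_split/= sumr_const card_ord -[(e * C) *+ n]mulr_natl mulrA.
  have C0 : 0 <= C by apply: sumr_ge0.
  by nra.
have uM : M \in unitmx.
  rewrite -row_free_unit -kermx_eq0; apply/eqP/row_matrixP => i; rewrite row0.
  have [] := est (row i (kermx M)) 0; first by apply/sub_kermxP/row_sub.
  rewrite [X in _ <= 2 * X]big1 => [|j _]; last by rewrite mxE normr0.
  rewrite mulr0 => C0 _; apply/rowP => j; apply/eqP.
  rewrite [eqbRHS]mxE -normr_le0; apply: le_trans C0.
  by rewrite (bigD1 j)//= lerDl sumr_ge0.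
have [] := est (\row_j d j *m invmx M) (\row_j d j); first by rewrite mulmxKV.
set c := _ *m _ => cC cd.
exists (c 0) => [k|j]; last first.
  have /rowP/(_ j) : c *m M = \row_j d j by rewrite mulmxKV.
  by rewrite !mxE.
have sumd : \sum_j `|(\row_j d j) 0 j| = D.
  by apply: eq_bigr => j _; rewrite mxE gtr0_norm.
rewrite sumd in cC; have := cd k; rewrite mxE ler_norml => /andP[+ _].
have := ler_wpM2l (ltW e0) cC; have := md k; lra.
Qed.

(** A positive combination of polynomials, each growing essentially on one of
    the intervals between consecutive nodes only, has any prescribed positive
    increments over these intervals. *)
Lemma monotone_interpolation (n : nat) (lam lam' : 'I_n.+1 -> R) :
  (0 < n)%N -> (forall i j : 'I_n.+1, (i < j)%N -> lam i < lam j) ->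
  (forall i j : 'I_n.+1, (i < j)%N -> lam' i < lam' j) ->
  exists phi : {poly R}, (exists2 c, 0 < c & forall x, c <= phi^`().[x]) /\
    forall k, phi.[lam k] = lam' k.
Proof.
move=> n0 hlam hlam'.
pose low (j : 'I_n) : 'I_n.+1 := widen_ord (leqnSn n) j.
pose up (j : 'I_n) : 'I_n.+1 := lift ord0 j.
have low_up j : (low j < up j)%N by [].
have homo (i j : 'I_n.+1) : (i <= j)%N -> lam i <= lam j.
  rewrite leq_eqVlt => /orP[/eqP/val_inj-> //|/hlam]; exact: ltW.
have d0 j : 0 < lam' (up j) - lam' (low j) by rewrite subr_gt0 hlam'.
have [e e0 He] := near_identity_pos_solution d0.
have sep k j : j != k ->
    lam (up j) <= lam (low k) \/ lam (up k) <= lam (low j).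
  rewrite -val_eqE neq_ltn => /orP[jk|kj]; [left|right]; exact: homo.
have lt_low_up j : lam (low j) < lam (up j) by exact: hlam.
have /choice[p Hp] := fun k => concentrated_poly e0 lt_low_up (sep k).
pose M : 'M[R]_n := \matrix_(k, j) ((p k).[lam (up j)] - (p k).[lam (low j)]).
have [k|k j jk|c c0 Hc] := He M.
- by rewrite mxE; have [_ ->] := Hp k.
- by rewrite mxE; have [_ _ ->] := Hp k.
pose psi : {poly R} := \sum_k c k *: p k.
have psi_incr j : psi.[lam (up j)] - psi.[lam (low j)] =
    lam' (up j) - lam' (low j).
  rewrite -Hc !horner_sum -sumrB; apply: eq_bigr => k _.
  by rewrite !hornerZ mxE mulrBr.
exists (psi + (lam' ord0 - psi.[lam ord0])%:P); split.
  pose k0 := Ordinal n0; have [[b b0 Hb] _ _] := Hp k0.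
  exists (c k0 * b); first by rewrite mulr_gt0.
  move=> x; rewrite derivD derivC addr0 raddf_sum horner_sum (bigD1 k0)//=.
  rewrite derivZ hornerZ; apply: ler_wpDr; last by rewrite ler_wpM2l// ltW.
  apply: sumr_ge0 => k _; rewrite derivZ hornerZ mulr_ge0 ?ltW//.
  by have [[b' b'0 Hb'] _ _] := Hp k; apply: lt_le_trans (Hb' x).
move=> [k]; elim: k => [|k IH] kn.
  rewrite (_ : Ordinal kn = ord0); last exact: val_inj.
  by rewrite hornerD hornerC addrC subrK.
have kn' : (k < n)%N by [].
have := psi_incr (Ordinal kn'); have := IH (ltnW kn).
rewrite (_ : Ordinal (ltnW kn) = low (Ordinal kn')); last exact: val_inj.
rewrite (_ : Ordinal kn = up (Ordinal kn')); last exact: val_inj.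
rewrite !hornerD !hornerC => <- /eqP; rewrite subr_eq => /eqP ->; ring.
Qed.

(** A lower bound on the derivative rather than mere positivity makes [phi]
    unbounded in both directions. *)
Lemma poly_bijection (phi : {poly R}) (c : R) : 0 < c ->
  (forall x, c <= phi^`().[x]) ->
  exists psi : R -> R, cancel psi (horner phi) /\ cancel (horner phi) psi.
Proof.
move=> c0 Hc; have incr : {homo horner phi : x y / x < y}.
  by apply: poly_incr_homo => x; apply: lt_le_trans (Hc x).
have surj y : exists x, phi.[x] = y.
  pose t := `|y - phi.[0]| / c + 1.
  have t0 : 0 < t by rewrite ltr_wpDl// divr_ge0// ltW.
  have tc : `|y - phi.[0]| <= c * t.
    by rewrite mulrDr mulr1 mulrC divfK ?gt_eqF// lerDl ltW.
  have [a _ Ea] := poly_mvt phi t0.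
  have nt0 : - t < 0 by rewrite oppr_lt0.
  have [b _ Eb] := poly_mvt phi nt0.
  have := ler_wpM2r (ltW t0) (Hc a); have := ler_wpM2r (ltW t0) (Hc b).
  rewrite subr0 in Ea; rewrite sub0r opprK in Eb.
  move: tc; rewrite ler_norml -Ea -Eb => /andP[t1 t2] t3 t4.
  have tt : - t <= t by lra.
  have [|x _] := @poly_ivt _ (phi - y%:P) _ _ tt.
    by rewrite !hornerE; lra.
  by rewrite /root !hornerE subr_eq0 => /eqP xy; exists x.
have [psi Hpsi] := choice surj.
exists psi; split=> // x; apply: contrapT => /eqP; rewrite neq_lt.
by case/orP => /incr; rewrite Hpsi ltxx.
Qed.

End Interpolation.

(** * Spectra of arrow matrices *)

Section ArrowSpectrum.

Lemma det_arrow (D : idomainType) (n : nat) (M : 'M[D]_n.+1) :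
  arrow_mx M -> \prod_(i < n) M (lift ord0 i) (lift ord0 i) != 0 ->
  \det M = M ord0 ord0 * \prod_(i < n) M (lift ord0 i) (lift ord0 i) -
    \sum_(i < n) M ord0 (lift ord0 i) * M (lift ord0 i) ord0 *
      \prod_(j < n | j != i) M (lift ord0 j) (lift ord0 j).
Proof.
move=> arM; set Q := \prod_i _ => Q0.
pose o i := \prod_(j < n | j != i) M (lift ord0 j) (lift ord0 j).
have Qo i : Q = M (lift ord0 i) (lift ord0 i) * o i by rewrite /Q (bigD1 i).
(* Column operations clearing the lower part of column 0, with denominators
   removed. *)
pose T : 'M[D]_(1 + n) :=
  block_mx Q%:M 0 (\col_i (- M (lift ord0 i) ord0 * o i)) 1%:M.
have dT : \det T = Q by rewrite det_lblock det1 mulr1 det_scalar expr1.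
pose N : 'M[D]_(1 + n) := M.
have drN : drsubmx N = diag_mx (\row_i M (lift ord0 i) (lift ord0 i)).
  apply/matrixP => i j; rewrite !mxE !rshift1.
  have [<-|ij] := eqVneq i j; first by rewrite mulr1n.
  by rewrite mulr0n; apply: arM; rewrite // (inj_eq lift_inj).
have NT : N *m T = block_mx (M ord0 ord0 * Q -
    \sum_i M ord0 (lift ord0 i) * M (lift ord0 i) ord0 * o i)%:M
    (ursubmx N) 0 (drsubmx N).
  have l0 : @lshift 1 n ord0 = ord0 by apply: val_inj.
  rewrite -{1}(submxK N) mulmx_block !mulmx0 !mulmx1 !add0r drN; congr block_mx.
    apply/matrixP => i j; rewrite !ord1 mul_mx_scalar !mxE mulr1n l0 mulrC -sumrN.
    congr (_ + _); apply: eq_bigr => k _.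
    by rewrite !mxE !rshift1 l0; ring.
  apply/matrixP => i j; rewrite mul_mx_scalar mul_diag_mx !mxE !rshift1 (Qo i).
  by rewrite [j]ord1 l0; ring.
apply: (mulIf Q0); transitivity (\det N * \det T); first by rewrite dT.
rewrite -det_mulmx NT det_ublock drN det_diag det_scalar expr1.
congr (_ * _); apply: eq_bigr => i _.
by rewrite mxE.
Qed.

Section Coordinates.
Context {R : realType} {n : nat}.
Notation E := ('rV[R]_n.+1 * ('rV[R]_n * 'rV[R]_n))%type.

Definition lower_diag (e : E) (i : 'I_n) : R := e.1 0 (lift ord0 i).

Definition offdiag_norm2 (e : E) (i : 'I_n) : R :=
  e.2.1 0 i ^+ 2 + e.2.2 0 i ^+ 2.

Lemma char_poly_arrow (A : 'M[R[i]%C]_n.+1) : hermitian_arrow A ->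
  char_poly A = map_poly (real_complex R)
    (prodX (fun k => (arrow_coord A).1 0 k) -
     omit_sum (lower_diag (arrow_coord A)) (offdiag_norm2 (arrow_coord A))).
Proof.
move=> [/hermitianE hA aA].
set e := arrow_coord A.
have AE k : A k k = (e.1 0 k)%:C%C.
  rewrite mxE; move: (hA k k); case: (A k k) => a b [/eqP].
  by rewrite -subr_eq0 opprK -mulr2n mulrn_eq0 => /eqP->.
have zE i : A ord0 (lift ord0 i) * A (lift ord0 i) ord0 =
    (offdiag_norm2 e i)%:C%C.
  rewrite (hA (lift ord0 i)) /offdiag_norm2 !mxE.
  case: (A _ _) => a b; apply/eqP; rewrite eq_complex /=.
  by apply/andP; split; apply/eqP; ring.
have Md (k : 'I_n.+1) : char_poly_mx A k k =
    map_poly (real_complex R) ('X - (e.1 0 k)%:P).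
  by rewrite !mxE eqxx mulr1n map_polyXsubC AE.
have Mo i j : i != j -> char_poly_mx A i j = - (A i j)%:P.
  by move=> /negPf ij; rewrite !mxE ij mulr0n sub0r.
rewrite /char_poly det_arrow; first last.
- by apply/prodf_neq0 => i _; rewrite Md map_poly_eq0 polyXsubC_eq0.
- by move=> i j ij i0 j0; rewrite Mo// aA// polyC0 oppr0.
rewrite rmorphB rmorph_prod rmorph_sum/= big_ord_recl Md.
congr (_ * _ - _); first by apply: eq_bigr => i _; rewrite Md.
apply: eq_bigr => i _; rewrite map_polyZ rmorph_prod/= -zE.
rewrite !Mo// mulrNN -polyCM mul_polyC; congr (_ *: _).
by apply: eq_bigr => j _; rewrite Md.
Qed.

Lemma spectrum_simple (A : 'M[R[i]%C]_n.+1) (p : {poly R})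
    (lam : 'I_n.+1 -> R) :
  injective lam -> char_poly A = map_poly (real_complex R) p ->
  spectrum A = range (fun k => (lam k)%:C%C) <-> p = prodX lam.
Proof.
move=> lam_inj Ap.
split=> [specA|pE].
  have pm : p \is monic.
    by rewrite -(map_monic (real_complex R)) -Ap char_poly_monic.
  have sp : size p = (size (codom lam)).+1.
    rewrite size_codom card_ord -(size_map_poly (real_complex R)) -Ap.
    exact: size_char_poly.
  have rp : all (root p) (codom lam).
    apply/allP => _ /codomP[k ->].
    have : spectrum A (lam k)%:C%C by rewrite specA; exists k.
    rewrite /spectrum/= eigenvalue_root_char Ap.
    by rewrite -[(lam k)%:C%C]/(real_complex R (lam k)) fmorph_root.
  rewrite (all_roots_prod_XsubC sp rp); last first.
    by rewrite uniq_rootsE; apply/injectiveP.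
  by rewrite (monicP pm) scale1r /prodX big_image.
move: Ap; rewrite pE => Ap.
apply/seteqP; split=> z /=.
  rewrite /spectrum/= eigenvalue_root_char Ap => rz.
  have : root (prodX (fun k => (lam k)%:C%C)) z.
    move: rz; rewrite rmorph_prod/= /prodX.
    by under eq_bigr do rewrite map_polyXsubC.
  by rewrite root_prodX => /existsP[k /eqP ->]; exists k.
move=> [k _ <-]; rewrite /spectrum/= eigenvalue_root_char Ap.
rewrite -[(lam k)%:C%C]/(real_complex R (lam k)) fmorph_root root_prodX.
by apply/existsP; exists k.
Qed.

Lemma prodX_split (e : E) :
  prodX (fun k => e.1 0 k) = ('X - (e.1 0 ord0)%:P) * prodX (lower_diag e).
Proof. exact: big_ord_recl. Qed.

(** The two sides are monic of degree [n.+1]; equal traces push the degree of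
    their difference below [n], the degree of [prodX a], and then divisibility
    by [prodX a] makes it vanish. *)
Lemma arrow_poly_eq (e : E) (lam : 'I_n.+1 -> R) (w : 'I_n -> R) :
  prodX (fun k => e.1 0 k) - omit_sum (lower_diag e) w = prodX lam <->
  \sum_k e.1 0 k = \sum_k lam k /\
  prodX (lower_diag e) %| prodX lam + omit_sum (lower_diag e) w.
Proof.
set a := lower_diag e; set W := omit_sum a w.
have sQ : size (prodX a) = n.+1.
  by rewrite size_prod_XsubC /index_enum -enumT size_enum_ord.
have sW : (size W <= n)%N.
  apply: (leq_trans (size_sum _ _ _)); apply/bigmax_leqP => i _.
  apply: (leq_trans (size_scale_leq _ _)).
  have := sQ; rewrite /prodX (bigD1 i)//= size_monicM ?monicXsubC//; last first.
    by apply: monic_neq0; apply: monic_prod => j _; apply: monicXsubC.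
  by rewrite size_XsubC add2n => -[->].
split=> [PE|[tr dv]].
  split; last by rewrite -PE subrK prodX_split dvdp_mull.
  by apply/eqP; rewrite -size_prodXB -PE opprB addrC subrK.
apply/eqP; rewrite -subr_eq0; apply: contraTT isT => nz.
set H := _ - _ in nz.
have sH : (size H <= n)%N.
  rewrite /H addrAC; apply: (leq_trans (size_polyD _ _)).
  by rewrite geq_max size_polyN sW andbT size_prodXB tr.
have : prodX a %| H.
  rewrite /H -addrA -opprD addrC [W + _]addrC dvdp_addl ?dvdpNr//.
  by rewrite prodX_split dvdp_mull.
by move=> /(dvdp_leq nz); rewrite sQ ltnNge sH.
Qed.

(** The corner entry occurs in the trace only; the rest of the condition is a
    divisibility of polynomials, which a change of variable can carry over. *)
Lemma isospectral_arrowE (lam : 'I_n.+1 -> R) (e : E) : injective lam ->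
  (arrow_coord @` isospectral_arrow lam) e <->
  \sum_k e.1 0 k = \sum_k lam k /\
  prodX (lower_diag e) %|
    prodX lam + omit_sum (lower_diag e) (offdiag_norm2 e).
Proof.
move=> lam_inj; rewrite -arrow_poly_eq.
split=> [[A [hA specA] <-]|eP].
  exact/(spectrum_simple lam_inj (char_poly_arrow hA)).
have [A hA eA] : (arrow_coord @` @hermitian_arrow R n) e.
  by have [_ _ /(_ e I)] := arrow_coord_bij R n.
exists A => //; split=> //.
by apply/(spectrum_simple lam_inj (char_poly_arrow hA)); rewrite eA.
Qed.

End Coordinates.

End ArrowSpectrum.

(** * Transport of arrow matrices along a polynomial *)

Section Transport.
Context {R : realType} {n : nat}.
Notation E := ('rV[R]_n.+1 * ('rV[R]_n * 'rV[R]_n))%type.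

Lemma Ck_on_diag k j : Ck_on k setT (fun e : E => e.1 0 j).
Proof.
apply: Ck_on_linear => [c e e'|e]; first by rewrite !mxE.
by apply: (@continuous_comp _ _ _ fst (fun M : 'rV[R]_n.+1 => M 0 j));
  [exact: cvg_fst|exact: coord_continuous].
Qed.

Lemma Ck_on_re k j : Ck_on k setT (fun e : E => e.2.1 0 j).
Proof.
apply: Ck_on_linear => [c e e'|e]; first by rewrite !mxE.
apply: (@continuous_comp _ _ _ snd (fun z : 'rV[R]_n * 'rV[R]_n => z.1 0 j));
  first exact: cvg_snd.
by apply: (@continuous_comp _ _ _ fst (fun M : 'rV[R]_n => M 0 j));
  [exact: cvg_fst|exact: coord_continuous].
Qed.

Lemma Ck_on_im k j : Ck_on k setT (fun e : E => e.2.2 0 j).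
Proof.
apply: Ck_on_linear => [c e e'|e]; first by rewrite !mxE.
apply: (@continuous_comp _ _ _ snd (fun z : 'rV[R]_n * 'rV[R]_n => z.2 0 j));
  first exact: cvg_snd.
by apply: (@continuous_comp _ _ _ snd (fun M : 'rV[R]_n => M 0 j));
  [exact: cvg_snd|exact: coord_continuous].
Qed.

(** The corner entry is chosen so that the trace is [t]. *)
Definition rescale (t : R) (a s : 'I_n -> R) (e : E) : E :=
  (\row_k oapp a (t - \sum_i a i) (unlift ord0 k),
   (\row_j (s j * e.2.1 0 j), \row_j (s j * e.2.2 0 j))).

Lemma Ck_on_rescale k t (a s : 'I_n -> E -> R) :
  (forall i, Ck_on k setT (a i)) -> (forall i, Ck_on k setT (s i)) ->
  Ck_on k setT (fun e => rescale t (a ^~ e) (s ^~ e) e).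
Proof.
move=> Ca Cs; apply: Ck_on_pair; last first.
  by apply: Ck_on_pair; apply: Ck_on_row => j; apply: Ck_onM => //;
    [exact: Ck_on_re|exact: Ck_on_im].
apply: Ck_on_row => j; case: unliftP => [i _|_] //=.
rewrite (_ : (fun _ => _) = cst t + cst (-1) * (fun e => \sum_i a i e)).
  apply: Ck_onD; first exact: Ck_on_cst.
  by apply: Ck_onM; [exact: Ck_on_cst|exact: Ck_on_sum].
by apply/funext => e; rewrite /GRing.add/= /GRing.mul/= mulN1r.
Qed.

Lemma rescale_diag t a s e : lower_diag (rescale t a s e) = a.
Proof. by apply/funext => i; rewrite /lower_diag/= mxE liftK. Qed.

Lemma rescale_trace t a s e : \sum_k (rescale t a s e).1 0 k = t.
Proof.
rewrite big_ord_recl/= mxE unlift_none [X in _ + X](eq_bigr a)/= ?subrK// => i _.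
by rewrite /= mxE liftK.
Qed.

Lemma rescale_norm2 t a s e :
  offdiag_norm2 (rescale t a s e) = fun i => s i ^+ 2 * offdiag_norm2 e i.
Proof. by apply/funext => i; rewrite /offdiag_norm2/= !mxE; ring. Qed.

Lemma rescale_rescale t t' a a' (s s' : 'I_n -> R) (e : E) :
  (forall i, s' i * s i = 1) -> \sum_k e.1 0 k = t' -> lower_diag e = a' ->
  rescale t' a' s' (rescale t a s e) = e.
Proof.
move=> ss tr ea; case: e tr ea => [d [x y]] /= tr ea; rewrite /rescale.
congr (_, (_, _)); apply/rowP => k; rewrite !mxE.
- case: unliftP => [i ->|->] /=; first by rewrite -ea.
  by rewrite -tr big_ord_recl/= -ea addrK.
- by rewrite mulrA ss mul1r.
- by rewrite mulrA ss mul1r.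
Qed.

End Transport.

Section Diffeomorphism.
Context {R : realType} {n : nat} (lam lam' : 'I_n.+1 -> R).
Notation E := ('rV[R]_n.+1 * ('rV[R]_n * 'rV[R]_n))%type.

Context {phi : {poly R}} {psi : R -> R}.
Hypothesis phi_deriv : forall x, 0 < phi^`().[x].
Hypothesis phiK : cancel (horner phi) psi.
Hypothesis psiK : cancel psi (horner phi).
Hypothesis phi_lam : forall k, phi.[lam k] = lam' k.

Lemma ddiff_gt0 a b : 0 < (ddiff phi b).[a].
Proof.
have incr := poly_incr_homo phi_deriv.
have [ab|ab|->] := ltgtP a b; last by rewrite ddiff_diag.
  rewrite -(nmulr_rlt0 _ (_ : a - b < 0)) ?subr_lt0// -horner_ddiff subr_lt0.
  exact: incr.
rewrite -(pmulr_rgt0 _ (_ : 0 < a - b)) ?subr_gt0// -horner_ddiff subr_gt0.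
exact: incr.
Qed.

Lemma Ck_on_ddiff (V : normedModType R) k (f g : V -> R) :
  Ck_on k setT f -> Ck_on k setT g ->
  Ck_on k setT (fun x => (ddiff phi (g x)).[f x]).
Proof.
move=> Cf Cg; rewrite (_ : (fun _ => _) = fun x => \sum_(m < size phi)
    (cst phi`_m * (fun y => \sum_(l < m)
       ((fun z => f z ^+ (m.-1 - l)) * (fun z => g z ^+ l)) y)) x); last first.
  by apply/funext => x; rewrite horner_ddiff_sum.
apply: Ck_on_sum => m; apply: Ck_onM; first exact: Ck_on_cst.
by apply: Ck_on_sum => l; apply: Ck_onM; apply: Ck_onX.
Qed.

Lemma weight_ratio_gt0 (a : 'I_n -> R) i : 0 < weight_ratio phi a lam i.
Proof. by rewrite divr_gt0// prodr_gt0// => j _; apply: ddiff_gt0. Qed.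

Lemma Ck_on_weight_ratio k (a : 'I_n -> E -> R) i :
  (forall i, Ck_on k setT (a i)) ->
  Ck_on k setT (fun e => weight_ratio phi (a ^~ e) lam i).
Proof.
move=> Ca; apply: Ck_onM.
  by apply: Ck_on_prod => j; apply: Ck_on_ddiff => //; exact: Ck_on_cst.
apply: Ck_on_inv.
  by move=> x; apply/prodf_neq0 => j _; rewrite gt_eqF// ddiff_gt0.
by apply: Ck_on_prod => j; apply: Ck_on_ddiff.
Qed.

Lemma Ck_on_psi (V : normedModType R) k (f : V -> R) :
  Ck_on k setT f -> Ck_on k setT (psi \o f).
Proof.
apply: (@Ck_on_comp_ode _ _ _ _ (fun y => (phi^`().[y])^-1)).
  move=> x; rewrite -[X in is_derive X](psiK (f x)).
  apply: (@is_derive_inverse _ (horner phi)); rewrite ?gt_eqF//.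
    by near=> z; apply: phiK.
  by near=> z; apply: continuous_horner.
move=> j Cg; apply: Ck_on_inv; first by move=> x; rewrite gt_eqF.
exact: Ck_on_horner.
Unshelve. all: by end_near. Qed.

Let scale (a : 'I_n -> R) i := Num.sqrt (weight_ratio phi a lam i).

Definition arrow_push (e : E) : E :=
  rescale (\sum_k lam' k) (fun i => phi.[lower_diag e i])
    (fun i => scale (lower_diag e) i) e.

(** The scaling factors of [arrow_push] taken at the preimage: no divided
    difference of [psi] is needed. *)
Definition arrow_pull (e : E) : E :=
  rescale (\sum_k lam k) (fun i => psi (lower_diag e i))
    (fun i => (scale (fun j => psi (lower_diag e j)) i)^-1) e.

Lemma scale_gt0 a i : 0 < scale a i.
Proof. by rewrite sqrtr_gt0 weight_ratio_gt0. Qed.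

Lemma scale2 a i : scale a i ^+ 2 = weight_ratio phi a lam i.
Proof. by rewrite sqr_sqrtr// ltW// weight_ratio_gt0. Qed.

Lemma Ck_on_push k : Ck_on k setT arrow_push.
Proof.
apply: Ck_on_rescale => i; first by apply: Ck_on_horner; exact: Ck_on_diag.
apply: Ck_on_sqrt; first by move=> e; exact: weight_ratio_gt0.
by apply: Ck_on_weight_ratio => j; exact: Ck_on_diag.
Qed.

Lemma Ck_on_pull k : Ck_on k setT arrow_pull.
Proof.
have Cpsi i : Ck_on k setT (fun e : E => psi (lower_diag e i)).
  by apply: Ck_on_psi; exact: Ck_on_diag.
apply: Ck_on_rescale => // i.
apply: Ck_on_inv; first by move=> e; rewrite gt_eqF ?scale_gt0.
apply: Ck_on_sqrt; first by move=> e; exact: weight_ratio_gt0.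
exact: Ck_on_weight_ratio.
Qed.

Lemma push_isospectral (e : E) : injective lam -> injective lam' ->
  (arrow_coord @` isospectral_arrow lam) e ->
  (arrow_coord @` isospectral_arrow lam') (arrow_push e).
Proof.
move=> li li' /(isospectral_arrowE _ li)[_ dv].
apply/(isospectral_arrowE _ li').
split; first exact: rescale_trace.
rewrite rescale_diag rescale_norm2.
rewrite (_ : lam' = fun k => phi.[lam k]); last first.
  by apply/funext => k; rewrite phi_lam.
rewrite (_ : (fun i => scale _ i ^+ 2 * _) = fun i =>
    weight_ratio phi (lower_diag e) lam i * offdiag_norm2 e i).
  by rewrite dvdp_weight_ratio// => a b; rewrite gt_eqF// ddiff_gt0.
by apply/funext => i; rewrite scale2.
Qed.

Lemma pull_isospectral (e : E) : injective lam -> injective lam' ->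
  (arrow_coord @` isospectral_arrow lam') e ->
  (arrow_coord @` isospectral_arrow lam) (arrow_pull e).
Proof.
move=> li li' /(isospectral_arrowE _ li')[_ dv].
apply/(isospectral_arrowE _ li).
split; first exact: rescale_trace.
rewrite rescale_diag rescale_norm2; set a := fun i => psi _.
rewrite -(@dvdp_weight_ratio _ phi); last first.
  by move=> x y; rewrite gt_eqF// ddiff_gt0.
have -> : (fun i => phi.[a i]) = lower_diag e.
  by apply/funext => i; rewrite psiK.
have -> : (fun k => phi.[lam k]) = lam' by apply/funext => k; rewrite phi_lam.
rewrite (_ : (fun i => weight_ratio _ _ _ _ * _) = offdiag_norm2 e)//.
apply/funext => i; rewrite exprVn scale2 mulrA divff ?mul1r//.
by rewrite gt_eqF// weight_ratio_gt0.
Qed.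

Lemma push_pullK (e : E) : injective lam ->
  (arrow_coord @` isospectral_arrow lam) e -> arrow_pull (arrow_push e) = e.
Proof.
move=> li /(isospectral_arrowE _ li)[tr _]; rewrite /arrow_pull.
rewrite /arrow_push rescale_diag; apply: rescale_rescale => //.
  move=> i; rewrite (_ : (fun j => _) = lower_diag e).
    by rewrite mulVf// gt_eqF// scale_gt0.
  by apply/funext => j; rewrite phiK.
by apply/funext => j; rewrite phiK.
Qed.

Lemma pull_pushK (e : E) : injective lam' ->
  (arrow_coord @` isospectral_arrow lam') e -> arrow_push (arrow_pull e) = e.
Proof.
move=> li /(isospectral_arrowE _ li)[tr _]; rewrite /arrow_push.
rewrite /arrow_pull rescale_diag; apply: rescale_rescale => //.
  by move=> i; rewrite mulfV// gt_eqF// scale_gt0.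
by apply/funext => j; rewrite psiK.
Qed.

End Diffeomorphism.

Theorem mainTheorem2 (R : realType) (n : nat) (hn : (1 <= n)%N)
    (lam lam' : 'I_n.+1 -> R)
    (hlam : forall i j : 'I_n.+1, (i < j)%N -> lam i < lam j)
    (hlam' : forall i j : 'I_n.+1, (i < j)%N -> lam' i < lam' j) :
  diffeomorphic (arrow_coord @` isospectral_arrow lam)
                (arrow_coord @` isospectral_arrow lam').
Proof.
have inj (l : 'I_n.+1 -> R) :
    (forall i j : 'I_n.+1, (i < j)%N -> l i < l j) -> injective l.
  move=> hl i j lij; apply: val_inj; case: (ltngtP i j) => // /hl.
    by rewrite lij ltxx.
  by rewrite lij ltxx.
have li := inj _ hlam; have li' := inj _ hlam'.
have [phi [[c c0 phi_c] phi_lam]] := monotone_interpolation hn hlam hlam'.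
have [psi [psiK phiK]] := poly_bijection c0 phi_c.
have phi0 x : 0 < phi^`().[x] by apply: lt_le_trans (phi_c x).
pose f := arrow_push lam lam' (phi := phi).
pose g := arrow_pull lam (phi := phi) (psi := psi).
exists f, g; split.
- split=> [e|e _]; first exact: push_isospectral.
  exists setT, f; split=> //; first exact: openT.
  by move=> k; exact: Ck_on_push.
- split=> [e|e _]; first exact: pull_isospectral.
  exists setT, g; split=> //; first exact: openT.
  by move=> k; exact: Ck_on_pull.
- by move=> e; exact: push_pullK.
- by move=> e; exact: pull_pushK.
Qed.
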